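(* There is a family $\mathcal{A}$ of directed sub-posets of $2^\omega$ with $|\mathcal{A}|=2^{\mathfrak{c}}$ such that for all distinct $P,Q\in\mathcal{A}$ we have $P\not\geq_T Q$ and $P\not\leq_T Q$.
   Context: $2^\omega$ is the set of functions $\omega\to\{0,1\}$ with the pointwise partial order; equivalently (via characteristic functions) the power set of $\omega$ ordered by inclusion. A sub-poset of $2^\omega$ is a subset with the induced order. $\mathfrak{c}$ is the cardinality of the continuum. A poset $P$ is directed if any two elements of $P$ have a common upper bound in $P$. A subset $C\subseteq P$ is cofinal if for every $p\in P$ there is $q\in C$ with $p\leq q$. For directed sets $P,Q$, $P\geq_T Q$ (equivalently $Q\leq_T P$; ''$Q$ is a Tukey quotient of $P$'') means that there is a map $\phi:P\to Q$ carrying cofinal subsets of $P$ to cofinal subsets of $Q$. *)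

(* Defs.v *)
From mathcomp Require Import all_boot all_order.
From mathcomp Require Import boolp classical_sets functions cardinality.

Set Implicit Arguments.
Unset Strict Implicit.
Unset Printing Implicit Defensive.

Local Open Scope classical_set_scope.
Local Open Scope order_scope.

(* The library orders [nat -> bool] pointwise (lemma [lefP]), with
   [false <= true].  Sub-posets are represented by sets [P : set T] over an
   ambient poset [T], carrying the induced order. *)
Notation pow_omega := (nat -> bool).

Section Tukey.
Context {d : Order.disp_t} {T : porderType d}.
Implicit Types P Q C : set T.

Definition directed P :=
  forall x y, P x -> P y -> exists z, [/\ P z, x <= z & y <= z].

Definition cofinal P C :=
  C `<=` P /\ forall p, P p -> exists2 q, C q & p <= q.

(* [{fun P >-> Q}] consists of functions on all of [T] that map [P] into [Q];
   only their values on [P] matter below. *)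
Definition tukey_ge P Q :=
  exists phi : {fun P >-> Q}, forall C, cofinal P C -> cofinal Q (phi @` C).

End Tukey.

(* Main.v *)
(* For M a subset of 2^omega, let [trees M] be the set of subtrees of the binary
   tree having only countably many branches, all in M, ordered by inclusion. A
   convergent sequence of [trees M] is bounded in it. If [trees M] >=_T [trees N]
   is witnessed by phi, pick for every y in N an element p_y of [trees M] such
   that phi(p) contains the tree of initial segments of y whenever p contains
   p_y. A countable dense subset of {(p_y, y) : y in N} then determines N as the
   image of [trees M] under its closure (a limit of bounded pairs is bounded).
   So at most c sets N lie below a given M: N = F_a(M) for one of c monotone
   operators F_a, and each point of F_a(M) comes from a countable subset of M.

   By Hajnal's free set theorem this yields 2^c pairwise incomparable sets,
   except when 2^c = c^+, where it is enough to find more than c of them. Let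
   kappa be least with c^kappa > c. The sets M_A are indexed by the branches A
   of the tree c^(<kappa), which has only c nodes, and built in c steps. A step
   handles an operator F_a and a node v: either it finds a fresh y produced by
   F_a from a countable set that can be put into all M_A with A through v, and
   excludes y from all sets; or it puts a fresh y into exactly the M_A with A
   off v. In both cases F_a(M_A') = M_A is prevented for A' through v and A off
   v, provided that the steps are ordered suitably; the order depends on whether
   cf(c) = kappa. *)

From Stdlib Require Import Relation_Operators Wellfounded.
Require Import Defs.
From mathcomp Require Import all_boot all_order.
From mathcomp Require Import boolp classical_sets functions cardinality.
From mathcomp Require Import wochoice.

Set Implicit Arguments.
Unset Strict Implicit.
Unset Printing Implicit Defensive.

Local Open Scope classical_set_scope.
Local Open Scope card_scope.

(** * Cardinal arithmetic *)

Lemma card_le_fun T U (A : set T) (B : set U) (f : T -> U) :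
  (forall x, A x -> B (f x)) ->
  (forall x y, A x -> A y -> f x = f y -> x = y) -> A #<= B.
Proof.
move=> fAB finj; have /injfunPex[g] : exists2 f : T -> U, set_fun A B f & set_inj A f.
  by exists f => [x /fAB//|x y /set_mem Ax /set_mem Ay]; exact: finj.
exact: inj_card_le g.
Qed.

Lemma card_leE T U (A : set T) (B : set U) (u : U) : A #<= B ->
  exists f : T -> U, (forall x, A x -> B (f x)) /\
    (forall x y, A x -> A y -> f x = f y -> x = y).
Proof.
move=> /card_leP[f]; pose g x := match pselect (A x) with
  | left Ax => set_val (f (SigSub (mem_set Ax))) | right _ => u end.
exists g; split=> [x Ax|x y Ax Ay]; rewrite /g.
  by case: pselect => // Ax'; exact: set_valP.
case: pselect => // Ax'; case: pselect => // Ay' /val_inj fxy.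
have := @inj _ _ _ f _ _ (mem_set I) (mem_set I) fxy.
by case.
Qed.

Lemma card_le_surj T U (A : set T) (B : set U) (g : U -> T) :
  (forall x, A x -> exists2 y, B y & g y = x) -> A #<= B.
Proof.
move=> gBA; have [->|/set0P[a Aa]] := eqVneq A set0; first exact: card_ge0.
have [u _ _] := gBA _ Aa.
have /choice[f fP] : forall x, exists y, A x -> B y /\ g y = x.
  move=> x; have [Ax|nAx] := pselect (A x); last by exists u.
  by have [y By gy] := gBA _ Ax; exists y.
apply: (@card_le_fun _ _ _ _ f) => [x /fP[]//|x y Ax Ay fxy].
by rewrite -(fP x Ax).2 fxy (fP y Ay).2.
Qed.

Lemma card_leX T T' U U' (A : set T) (A' : set T') (B : set U) (B' : set U') :
  A #<= B -> A' #<= B' -> A `*` A' #<= B `*` B'.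
Proof.
move=> AB AB'; have [->|/set0P[[a a'] [/= Aa Aa']]] := eqVneq (A `*` A') set0.
  exact: card_ge0.
have [u _] : B !=set0.
  by apply/set0P/eqP => B0; move: AB Aa; rewrite B0 card_le0 => /eqP ->.
have [u' _] : B' !=set0.
  by apply/set0P/eqP => B0; move: AB' Aa'; rewrite B0 card_le0 => /eqP ->.
have [f [fB fI]] := card_leE u AB.
have [f' [fB' fI']] := card_leE u' AB'.
apply: (@card_le_fun _ _ _ _ (fun z => (f z.1, f' z.2))) => [[x x'] [/= ? ?]|].
  by split; [exact: fB|exact: fB'].
move=> [x x'] [y y'] [/= ? ?] [/= ? ?] [/fI -> // /fI' -> //].
Qed.

Lemma card_le_bigcup I T U (D : set I) (F : I -> set T) (B : set U) :
  (forall i, D i -> F i #<= B) -> \bigcup_(i in D) F i #<= D `*` B.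
Proof.
move=> FB; have [->|/set0P[x0 [i0 Di0 Fi0]]] := eqVneq (\bigcup_(i in D) F i) set0.
  exact: card_ge0.
have [u _] : B !=set0.
  apply/set0P/eqP => B0; move: (FB _ Di0) Fi0.
  by rewrite B0 card_le0 => /eqP ->.
have /choice[f fP] : forall i, exists f : T -> U, D i ->
    (forall x, F i x -> B (f x)) /\ (forall x y, F i x -> F i y -> f x = f y -> x = y).
  move=> i; have [Di|nDi] := pselect (D i); last by exists (fun=> u).
  by have [f fP] := card_leE u (FB _ Di); exists f.
have /choice[k kP] : forall x, exists i, (\bigcup_(i in D) F i) x -> D i /\ F i x.
  move=> x; have [[i Di Fi]|nx] := pselect ((\bigcup_(i in D) F i) x); last by exists i0.
  by exists i.
apply: (@card_le_fun _ _ _ _ (fun x => (k x, f (k x) x))) => [x /kP[Dk Fk]|x y].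
  by split => //=; apply: (fP _ Dk).1.
move=> /kP[Dk Fk] /kP[Dk' Fk'] [kxy]; rewrite -kxy in Fk' Dk' *.
by apply: (fP _ Dk).2.
Qed.

(** By Zorn there is a maximal partial injection from [A] to [B]; if it were neither total nor onto,
    a pair could be added. *)
Lemma card_le_total T U (A : set T) (B : set U) : A #<= B \/ B #<= A.
Proof.
pose P (G : set (T * U)) := [/\ G `<=` A `*` B,
  forall x y y', G (x, y) -> G (x, y') -> y = y' &
  forall x x' y, G (x, y) -> G (x', y) -> x = x'].
have [F FP totF|G [[GAB Gf Gi] Gmax]] := @Zorn_bigcup _ P.
  split.
  - by move=> z [G /FP[GAB _ _] Gz]; exact: GAB.
  - move=> x y y' [G FG Gxy] [H FH Hxy].
    have [GH|HG] := totF _ _ FG FH.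
      by have [_ h _] := FP _ FH; apply: (h x) => //; exact: GH.
    by have [_ h _] := FP _ FG; apply: (h x) => //; exact: HG.
  - move=> x x' y [G FG Gxy] [H FH Hxy].
    have [GH|HG] := totF _ _ FG FH.
      by have [_ _ h] := FP _ FH; apply: (h x x' y) => //; exact: GH.
    by have [_ _ h] := FP _ FG; apply: (h x x' y) => //; exact: HG.
have [hA|/existsNP[a /not_implyP[Aa Ga]]] :=
    pselect (forall x, A x -> exists y, G (x, y)).
  left; have [->|/set0P[a Aa]] := eqVneq A set0; first exact: card_ge0.
  have [u _] := hA _ Aa.
  have /choice[f fP] : forall x, exists y, A x -> G (x, y).
    move=> x; have [/hA[y]|nAx] := pselect (A x); last by exists u.
    by exists y.
  apply: (@card_le_fun _ _ _ _ f) => [x /fP/GAB[]//|x y /fP Gx /fP Gy fxy].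
  by apply: (Gi _ _ (f x)) => //; rewrite fxy.
have [hB|/existsNP[b /not_implyP[Bb Gb]]] :=
    pselect (forall y, B y -> exists x, G (x, y)).
  right; have /choice[f fP] : forall y, exists x, B y -> G (x, y).
    move=> y; have [/hB[x]|nBy] := pselect (B y); last by exists a.
    by exists x.
  apply: (@card_le_fun _ _ _ _ f) => [x /fP/GAB[]//|x y /fP Gx /fP Gy fxy].
  by apply: (Gf (f x)) => //; rewrite fxy.
exfalso; apply: (Gmax (G `|` [set (a, b)])).
  split; first by move=> z ?; left.
  by move=> /(_ (a, b)) h; apply: Ga; exists b; apply: h; right.
split.
- by move=> z [/GAB|->].
- move=> x y y' [Gxy|[xa yb]] [Gxy'|[xa' yb']]; last by rewrite yb yb'.
  + exact: Gf Gxy Gxy'.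
  + by case: Ga; exists y; rewrite -xa'.
  + by case: Ga; exists y'; rewrite -xa.
- move=> x x' y [Gxy|[xa yb]] [Gxy'|[xa' yb']]; last by rewrite xa xa'.
  + exact: Gi Gxy Gxy'.
  + by case: Gb; exists x; rewrite -yb'.
  + by case: Gb; exists x'; rewrite -yb.
Qed.

(** * Well-orders *)

Definition seg T (lt : T -> T -> Prop) (x : T) : set T := [set y | lt y x].

Definition wo T (lt : T -> T -> Prop) :=
  [/\ well_founded lt, forall x y z, lt x y -> lt y z -> lt x z &
      forall x y, [\/ lt x y, x = y | lt y x]].

(** Recursion by choice along [lt]. As [P x h] depends only on [h] below [x], a total [h] with dummy
    value [o0] elsewhere stands for the partial history. *)
Lemma wf_choice T O (lt : T -> T -> Prop) (P : T -> (T -> O) -> O -> Prop) (o0 : O) :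
  well_founded lt ->
  (forall x h h' v, (forall y, lt y x -> h y = h' y) -> P x h v -> P x h' v) ->
  (forall x h, exists v, P x h v) ->
  exists o, forall x, P x o (o x).
Proof.
move=> wf Ploc Pex.
have /choice[s sP] : forall xh : T * (T -> O), exists v, P xh.1 xh.2 v.
  by move=> [x h]; exact: Pex.
pose m x (r : forall y, lt y x -> O) (y : T) :=
  match pselect (lt y x) with left h => r y h | right _ => o0 end.
pose step x (r : forall y, lt y x -> O) := s (x, m x r).
pose o := Fix wf (fun=> O) step.
have oE x : o x = step x (fun y _ => o y).
  rewrite /o Fix_eq // => {}x f g fg; rewrite /step; congr (s (x, _)).
  by rewrite /m; apply/funext => y; case: pselect.
exists o => x; rewrite oE; apply: (Ploc x (m x (fun y _ => o y))); last exact: (sP (x, _)).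
by move=> y yx; rewrite /m; case: pselect.
Qed.

Lemma wf_minP T (lt : T -> T -> Prop) (A : set T) : well_founded lt -> A !=set0 ->
  exists2 x, A x & forall y, A y -> ~ lt y x.
Proof.
move=> wf [a Aa]; apply: contrapT => /forall2NP noMin.
suff : forall x, ~ A x by move/(_ a).
apply: (well_founded_ind wf) => x IH Ax.
by have [//|] := noMin x; apply => y Ay /IH.
Qed.

Lemma wo_irr T (lt : T -> T -> Prop) x : wo lt -> ~ lt x x.
Proof.
case=> wf _ _; elim/(well_founded_ind wf) : x => x IH xx; exact: (IH x).
Qed.

Lemma wo_exists T : exists lt : T -> T -> Prop, wo lt.
Proof.
have [R Rwo] := well_ordering_principle {classic T}.
have ex (A : set T) : A !=set0 -> exists z, A z /\ forall x, A x -> R z x.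
  move=> [a Aa]; have [|z [[Az zmin] _]] := Rwo (fun x => `[< A x >]).
    by exists a; apply/asboolP.
  exists z; split; first exact/asboolP.
  by move=> x Ax; apply: zmin; apply/asboolP.
have uniq2 (x y : T) : R x y -> R y x -> x = y.
  move=> xy yx; have [|z [_ zu]] := Rwo (fun t => `[< t = x \/ t = y >]).
    by exists x; apply/asboolP; left.
  have Rr (t : T) : R t t by have [|w [-> h]] := ex [set t]; [exists t|exact: h].
  rewrite -(zu x); last first.
    split; first by apply/asboolP; left.
    by move=> t /asboolP[]->.
  apply: zu; split; first by apply/asboolP; right.
  by move=> t /asboolP[]->.
have tot (x y : T) : R x y \/ R y x.
  have [|z [[] -> h]] := ex [set t | t = x \/ t = y]; first by exists x; left.
    by left; apply: h; right.
  by right; apply: h; left.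
exists (fun x y => R x y /\ x <> y); split.
- move=> x; apply: contrapT => nx.
  have [|z [nz zmin]] := ex [set t | ~ Acc (fun x y => R x y /\ x <> y) t].
    by exists x.
  apply: nz; split=> y [yz nyz]; apply: contrapT => /zmin zy.
  by apply: nyz; exact: uniq2.
- move=> x y z [xy nxy] [yz nyz].
  have [|w [wE h]] := ex [set t | [\/ t = x, t = y | t = z]].
    by exists x; apply: Or31.
  have xw : w = x.
    case: wE => // wE; exfalso.
      by apply: nxy; apply: uniq2 => //; rewrite -wE; apply: h; apply: Or31.
    by apply: nyz; apply: uniq2 => //; rewrite -wE; apply: h; apply: Or32.
  rewrite xw in h; split; first by apply: h; exact: Or33.
  by move=> xz; apply: nxy; apply: uniq2 => //; rewrite xz.
- move=> x y; have [->|nxy] := pselect (x = y); first exact: Or32.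
  by have [xy|yx] := tot x y; [apply: Or31|apply: Or33; split => // yx'; apply: nxy].
Qed.

(* The order type is a cardinal. *)
Definition initial_wo T (lt : T -> T -> Prop) :=
  wo lt /\ forall x, ~ ([set: T] #<= seg lt x).

(** If some segment is as large as [T], take the first one and pull [lt] back along an injection of
    [T] into it. *)
Lemma initial_wo_exists T : exists lt : T -> T -> Prop, initial_wo lt.
Proof.
have [lt ltwo] := wo_exists T; have [wf tr tot] := ltwo.
have [big|nbig] := pselect (exists x, [set: T] #<= seg lt x); last first.
  by exists lt; split => // x xb; apply: nbig; exists x.
have [x xb xmin] := wf_minP wf big.
have [f [fseg finj]] := card_leE x xb.
exists (fun y z => lt (f y) (f z)); split.
  split.
  - exact: wf_inverse_image.
  - by move=> a b c; exact: tr.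
  - move=> a b; have [ab|/finj ab|ba] := tot (f a) (f b).
    + exact: Or31.
    + by apply: Or32; exact: ab.
    + exact: Or33.
move=> y yb; apply: (xmin (f y)); last exact: fseg.
apply: (card_le_trans yb); apply: (@card_le_fun _ _ _ _ f) => // a b _ _.
exact: finj.
Qed.

(** Greedy injection: at each point of [A], the values taken earlier do not exhaust [B]. *)
Lemma card_le_wo T U (lt : T -> T -> Prop) (A : set T) (B : set U) : wo lt ->
  (forall x, A x -> ~ (B #<= seg lt x `&` A)) -> A #<= B.
Proof.
move=> [wf tr tot] small; have [->|/set0P[a Aa]] := eqVneq A set0.
  exact: card_ge0.
have [b _] : B !=set0.
  by apply/set0P/eqP => B0; apply: (small _ Aa); rewrite B0; exact: card_ge0.
have [||f fP] := @wf_choice T U lt (fun x h v => A x ->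
    B v /\ forall y, lt y x -> A y -> h y <> v) b wf.
- move=> x h h' v hh' vP Ax; have [Bv vh] := vP Ax; split=> // y yx Ay.
  by rewrite -hh' //; exact: vh.
- move=> x h; have [Ax|nAx] := pselect (A x); last by exists b.
  have := small _ Ax; apply: contra_notP => /forallNP hB.
  apply: (@card_le_surj _ _ _ _ h) => v Bv; apply: contrapT => nv.
  by apply: (hB v) => _; split=> // y yx Ay hy; apply: nv; exists y.
apply: (@card_le_fun _ _ _ _ f) => [x /fP[]//|x y Ax Ay fxy].
have [xy|//|yx] := tot x y.
  by have [_ h] := fP _ Ay; case: (h _ xy Ax).
by have [_ h] := fP _ Ax; case: (h _ yx Ay).
Qed.
Lemma wo_preim T U (lt : U -> U -> Prop) (f : T -> U) : wo lt -> injective f ->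
  wo (fun x y => lt (f x) (f y)).
Proof.
move=> [wf tr tot] finj; split; first exact: wf_inverse_image.
- by move=> a b c; exact: tr.
- move=> a b; have [ab|/finj ab|ba] := tot (f a) (f b).
  + exact: Or31.
  + exact: Or32.
  + exact: Or33.
Qed.

Lemma slexprodE T U (lt : T -> T -> Prop) (lt' : U -> U -> Prop) p q :
  slexprod T U lt lt' p q -> lt p.1 q.1 \/ p.1 = q.1 /\ lt' p.2 q.2.
Proof. by case=> *; [left|right]. Qed.

Lemma wo_lex T U (lt : T -> T -> Prop) (lt' : U -> U -> Prop) : wo lt -> wo lt' ->
  wo (slexprod T U lt lt').
Proof.
move=> [wf tr tot] [wf' tr' tot']; split; first exact: wf_slexprod.
- move=> x y z [x1 y1 x2 y2 xy|x1 x2 y2 xy] yz; inversion yz; subst.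
  + by apply: left_slex; apply: tr; eassumption.
  + exact: left_slex.
  + exact: left_slex.
  + by apply: right_slex; apply: tr'; eassumption.
- move=> [x x'] [y y']; have [xy|->|yx] := tot x y.
  + by apply: Or31; exact: left_slex.
  + have [xy'|->|yx'] := tot' x' y'.
    * by apply: Or31; exact: right_slex.
    * exact: Or32.
    * by apply: Or33; exact: right_slex.
  + by apply: Or33; exact: left_slex.
Qed.

(** * Squares of infinite sets *)

Lemma infinite_ge T U (A : set T) (B : set U) :
  infinite_set A -> A #<= B -> infinite_set B.
Proof. by move=> Ainf AB /(card_le_finite AB). Qed.

Lemma card_le_add1 T (A : set T) a : infinite_set A -> A `*` A #<= A ->
  A `|` [set a] #<= A.
Proof.
move=> /infiniteP Ainf sqA; apply: card_le_trans sqA.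
have [f [fA finj]] := card_leE a Ainf.
have f01 : f 0 <> f 1 by move=> /finj; move/(_ I I).
have fA' n : A (f n) by apply: fA.
apply: (@card_le_fun _ _ _ _
  (fun x => if pselect (x = a) then (f 1, f 1) else (x, f 0))).
  move=> x [Ax|->]; case: pselect => // xa; split => //=.
move=> x y _ _; case: pselect => xa; case: pselect => ya /=.
- by rewrite xa ya.
- by move=> [_ f10]; case: f01.
- by move=> [_ f10]; case: f01.
- by move=> [].
Qed.

(* Order the square by the maximum, then lexicographically: its proper initial
   segments lie in squares of proper initial segments of [D]. *)
Lemma card_sq_down T (lt : T -> T -> Prop) (D : set T) : wo lt -> infinite_set D ->
  (forall x, D x -> ~ (D #<= seg lt x)) ->
  (forall x, D x -> infinite_set (seg lt x) -> seg lt x `*` seg lt x #<= seg lt x) ->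
  D `*` D #<= D.
Proof.
move=> ltwo Dinf Dseg Dsq; have [wf tr tot] := ltwo.
pose m (z : T * T) := if pselect (lt z.1 z.2) then z.2 else z.1.
have mP z w : lt (m w) (m z) \/ m w = m z ->
    let M := seg lt (m z) `|` [set m z] in M w.1 /\ M w.2.
  have sub a b : lt a (m w) \/ a = m w -> lt (m w) b \/ m w = b ->
      lt a b \/ a = b.
    move=> [aw|->] // [wb|<-]; left => //; exact: tr wb.
  move=> wz /=; split; apply: sub wz; rewrite /m; case: pselect => [|nw] /=; auto.
  by have [//||] := tot w.1 w.2; auto.
pose lt2 := fun z w : T * T =>
  slexprod T (T * T) lt (slexprod T T lt lt) (m z, z) (m w, w).
have lt2wo : wo lt2.
  apply: (@wo_preim _ _ _ (fun z => (m z, z))); last first.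
    by move=> z w /(congr1 snd).
  by apply: (wo_lex ltwo); exact: wo_lex.
apply: (card_le_wo lt2wo) => z [Dz1 Dz2] small.
have Dm : D (m z) by rewrite /m; case: pselect.
pose M := seg lt (m z) `|` [set m z].
have {}small : D #<= M `*` M.
  apply: (card_le_trans small); apply: subset_card_le => w [wz _].
  by apply: mP; have [|[]] := slexprodE wz; [left|right].
have [fin|inf] := pselect (finite_set (seg lt (m z))).
  apply: Dinf; apply: card_le_finite small _; apply: finite_setX;
    by rewrite finite_setU; split => //; exact: finite_set1.
apply: (Dseg _ Dm); apply: (card_le_trans small).
apply: card_le_trans (Dsq _ Dm inf).
by apply: card_leX; apply: card_le_add1 => //; exact: Dsq.
Qed.

Lemma card_sq_seg T (lt : T -> T -> Prop) x : wo lt -> infinite_set (seg lt x) ->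
  seg lt x `*` seg lt x #<= seg lt x.
Proof.
move=> ltwo; have [wf tr tot] := ltwo.
elim/(well_founded_ind wf) : x => x IH inf.
have [[y yx xy]|ny] := pselect (exists2 y, lt y x & seg lt x #<= seg lt y).
  have yinf := infinite_ge inf xy.
  apply: (card_le_trans (card_leX xy xy)); apply: (card_le_trans (IH _ yx yinf)).
  by apply: subset_card_le => z zy; exact: tr zy yx.
apply: (card_sq_down ltwo inf) => [y yx xy|y yx]; last exact: IH.
by apply: ny; exists y.
Qed.

Lemma card_sq T (A : set T) : infinite_set A -> A `*` A #<= A.
Proof.
move=> Ainf; have [lt [ltwo ltini]] := initial_wo_exists A.
have /andP[AT TA] : (A #<= [set: A]) && ([set: A] #<= A).
  by rewrite -card_eq_le card_setT_sym.
apply: (card_le_trans (card_leX AT AT)); apply: card_le_trans TA.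
apply: (card_sq_down ltwo) => [|x _|x _]; first exact: infinite_ge AT.
  exact: ltini.
exact: card_sq_seg.
Qed.

Lemma card_nle_X T U V (A : set T) (B : set U) (C : set V) : infinite_set A ->
  ~ (A #<= B) -> ~ (A #<= C) -> ~ (A #<= B `*` C).
Proof.
move=> Ainf AB AC ABC; have [BC|CB] := card_le_total B C.
  apply: AC; have ACC := card_le_trans ABC (card_leX BC (card_lexx C)).
  apply: (card_le_trans ACC); apply: card_sq => Cfin; apply: Ainf.
  by apply: card_le_finite ACC _; exact: finite_setX.
apply: AB; have ABB := card_le_trans ABC (card_leX (card_lexx B) CB).
apply: (card_le_trans ABB); apply: card_sq => Bfin; apply: Ainf.
by apply: card_le_finite ABB _; exact: finite_setX.
Qed.

(** * Free sets *)

Lemma card_option T : infinite_set [set: T] -> [set: option T] #<= [set: T].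
Proof.
move=> Tinf; have sT := @card_some T setT.
have Sinf : infinite_set (some @` [set: T]) by rewrite (eq_finite_set sT).
have := card_le_add1 None Sinf (card_sq Sinf); rewrite (card_le_eqr sT).
apply: card_le_trans; apply: subset_card_le => -[x _|_]; last by right.
by left; exists x.
Qed.

Lemma card_segU1 T (lt : T -> T -> Prop) x : infinite_set [set: T] ->
  initial_wo lt -> ~ ([set: T] #<= seg lt x `|` [set x]).
Proof.
move=> Tinf [ltwo ini] Tx.
have [fin|inf] := pselect (finite_set (seg lt x)).
  apply: Tinf; apply: card_le_finite Tx _.
  by rewrite finite_setU; split => //; exact: finite_set1.
apply: (ini x); apply: (card_le_trans Tx).
by apply: card_le_add1 => //; exact: card_sq.
Qed.

Definition free_set L Xi (f : Xi -> L -> L) (Y : set L) :=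
  forall x y, Y x -> Y y -> x <> y -> forall xi, f xi x <> y.

(* Fill the colour classes [i] in [I] greedily in order of type [L]. If the
   class [i] gets stuck at stage [h i], every point outside a set smaller than
   [L] is mapped by some [f xi] into each class stuck by then, and the classes
   are disjoint: hence at most [Xi] classes are stuck before any given stage. *)
Lemma greedy_free_set L Xi J (f : Xi -> L -> L) (lt : L -> L -> Prop) (I : set J) :
  initial_wo lt -> infinite_set [set: Xi] ->
  ~ (I #<= [set: Xi]) -> ~ ([set: L] #<= I) ->
  (exists Y : set L, [set: L] #<= Y /\ free_set f Y) \/
  exists h : J -> L, forall x, [set i | I i /\ ~ lt x (h i)] #<= [set: Xi].
Proof.
move=> [ltwo ini] Xinf IX LI; have [wf tr tot] := ltwo.
have IL : I #<= [set: L] by case: (card_le_total I [set: L]) => // /LI.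
have LX : ~ ([set: L] #<= [set: Xi]) by move=> LX; apply: IX; exact: card_le_trans LX.
have XL : [set: Xi] #<= [set: L].
  by case: (card_le_total [set: Xi] [set: L]) => // /LX.
have Linf := infinite_ge Xinf XL.
have [i0 Ii0] : I !=set0.
  by apply/set0P/eqP => I0; apply: IX; rewrite I0; exact: card_ge0.
have [l0 _] : [set: L] !=set0 by exact: infinite_setN0.
have [g [_ ginj]] : exists g : L * J -> L,
    (forall x, (setT `*` I) x -> setT (g x)) /\
    (forall x y, (setT `*` I) x -> (setT `*` I) y -> g x = g y -> x = y).
  apply: (card_leE l0); apply: (@card_le_trans _ _ _ ([set: L] `*` [set: L])).
    exact: card_leX.
  exact: card_sq.
(* The slot [g (x, j)] is stage [x] of class [j]; [t] recovers the class from the slot. *)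
have /choice[t tP] : forall a, exists i, forall x j, I j -> g (x, j) = a -> i = j.
  move=> a; have [[j [x Ij gxj]]|na] :=
      pselect (exists j, exists2 x, I j & g (x, j) = a).
    exists j => x' j' Ij'; rewrite -gxj => /ginj.
    by move=> /(_ (conj Logic.I Ij') (conj Logic.I Ij))[].
  by exists i0 => x j Ij gxj; case: na; exists j; exists x.
pose good a (h : L -> option L) y := forall b z, lt b a -> h b = Some z ->
  z <> y /\ (t b = t a -> forall xi, f xi z <> y /\ f xi y <> z).
have [||o oP] := @wf_choice L (option L) lt (fun a h v =>
    if v is Some y then good a h y else forall y, ~ good a h y) None wf.
- move=> a h h' v hh'; have goodE y : good a h y <-> good a h' y.
    by split=> hy b z ba; [rewrite -hh' //|rewrite hh' //]; exact: hy.
  case: v => [y /goodE//|hv y]; rewrite -goodE; exact: hv.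
- move=> a h; have [[y hy]|/forallNP hn] := pselect (exists y, good a h y).
    by exists (Some y).
  by exists None.
have oinj a b y : o a = Some y -> o b = Some y -> a = b.
  move=> oa ob; have [ab|//|ba] := tot a b.
    by have := oP b; rewrite ob => /(_ _ _ ab oa)[].
  by have := oP a; rewrite oa => /(_ _ _ ba ob)[].
have [[i [Ii iok]]|fails] :=
    pselect (exists i, I i /\ forall a, t a = i -> o a <> None).
  left; exists [set y | exists2 a, t a = i & o a = Some y]; split.
    have /choice[e eP] : forall x, exists y, o (g (x, i)) = Some y.
      move=> x; case E : (o (g (x, i))) => [y|]; first by exists y.
      by case: (iok _ _ E); exact: tP.
    apply: (@card_le_fun _ _ _ _ e) => [x _|x y _ _ exy].
      by exists (g (x, i)) => //; exact: tP.
    have := oinj _ _ _ (eP x); rewrite exy => /(_ _ (eP y)) /ginj.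
    by move=> /(_ (conj Logic.I Ii) (conj Logic.I Ii))[].
  move=> x y [a ta oa] [b tb ob] xy xi; have tab : t a = t b by rewrite ta tb.
  have [ab|ab|ba] := tot a b.
  - by have := oP b; rewrite ob => /(_ _ _ ab oa)[_ /(_ tab xi)[]].
  - by move: oa; rewrite ab ob => -[yx]; case: xy.
  - by have := oP a; rewrite oa => /(_ _ _ ba ob)[_ /(_ (esym tab) xi)[]].
right.
have /choice[h hP] : forall i, exists a, I i -> t a = i /\ o a = None.
  move=> i; have [Ii|nIi] := pselect (I i); last by exists l0.
  have [a [ta oa]] : exists a, t a = i /\ o a = None.
    apply: contrapT => /forallNP na; apply: fails; exists i; split => // a ta oa.
    by apply: (na a).
  by exists a.
exists h => x.
pose M := seg lt x `|` [set x].
(* The points chosen in slots up to [x] and their images under [f]: too few to cover [L]. A class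
   stuck by then can refuse a [z] outside [E] only because some [f xi z] was chosen for that
   class. *)
pose E := \bigcup_(a in M) [set y | exists w, o a = Some w /\
  exists2 k, setT k & (if k is Some xi then f xi w else w) = y].
have LE : ~ ([set: L] #<= E).
  move=> LE; have : E #<= M `*` [set: option Xi].
    apply: card_le_bigcup => a _.
    case oa : (o a) => [w|]; last first.
      by apply: (@card_le_trans _ _ _ (@set0 L)); [apply: subset_card_le => y [w []]|
        exact: card_ge0].
    apply: (@card_le_surj _ _ _ _ (fun k => if k is Some xi then f xi w else w)).
    by move=> y [_ [[<-]]] [k]; exists k.
  move=> /(card_le_trans LE); apply: card_nle_X => //; first exact: card_segU1.
  by move=> /card_le_trans /(_ (card_option Xinf)).
have [z Ez] : exists z, ~ E z.
  apply: contrapT => /forallNP nE; apply: LE; apply: subset_card_le => z _.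
  exact: contrapT.
have Ez' a w : M a -> o a = Some w -> w <> z /\ forall xi, f xi w <> z.
  move=> Ma oa; split=> [wz|xi wz]; apply: Ez; exists a => //; exists w; split=> //.
    by exists None.
  by exists (Some xi).
have [xi0 _] : [set: Xi] !=set0 by exact: infinite_setN0.
have /choice[k kP] : forall i, exists xi, I i /\ ~ lt x (h i) ->
    exists2 b, t b = i & o b = Some (f xi z).
  move=> i; have [[Ii xi]|nIi] := pselect (I i /\ ~ lt x (h i)); last by exists xi0.
  have [ti oi] := hP _ Ii; have := oP (h i); rewrite oi => /(_ z) ngood.
  apply: contrapT => nk; apply: ngood => b w bh ob.
  have Mb : M b.
    by left; have [hx|<-//|//] := tot (h i) x; exact: tr bh hx.
  have [wz fwz] := Ez' _ _ Mb ob; split=> // tb xi'; split=> // fz.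
  by apply: nk; exists xi' => _; exists b; rewrite ?fz // tb.
apply: (@card_le_fun _ _ _ _ k) => // i j /kP[b tb ob] /kP[c tc oc] kij.
by rewrite -tb -tc; congr t; apply: oinj ob _; rewrite kij.
Qed.

(* Hajnal's free set theorem. If all classes get stuck, then [L] has a cofinal
   subset of size at most [I], and a larger set of colours, still smaller than
   [L], cannot get stuck. *)
Theorem large_free_set L Xi J (f : Xi -> L -> L) (I : set J) :
  infinite_set [set: Xi] -> ~ (I #<= [set: Xi]) -> ~ ([set: L] #<= I) ->
  exists Y : set L, [set: L] #<= Y /\ free_set f Y.
Proof.
move=> Xinf IX LI; have [lt ini] := initial_wo_exists L.
have [ltwo ltini] := ini.
have [//|[h hP]] := greedy_free_set f ini Xinf IX LI.
have XI : [set: Xi] #<= I by case: (card_le_total [set: Xi] I) => // /IX.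
have sqI := card_sq (infinite_ge Xinf XI).
have hcof x : exists2 i, I i & lt x (h i).
  apply: contrapT => /forall2NP nx; apply: IX; apply: card_le_trans (hP x).
  by apply: subset_card_le => i Ii; split=> //; have [//|] := nx i.
have [i0 Ii0 big] : exists2 i, I i & ~ (seg lt (h i) #<= I).
  apply: contrapT => /forall2NP nx; apply: LI; apply: card_le_trans sqI.
  apply: (@card_le_trans _ _ _ (\bigcup_(i in I) seg lt (h i))).
    by apply: subset_card_le => x _; have [i Ii xi] := hcof x; exists i.
  by apply: card_le_bigcup => i Ii; have [//|/contrapT] := nx i.
have IX' : ~ (seg lt (h i0) #<= [set: Xi]) by move=> /card_le_trans /(_ XI).
have [//|[h' hP']] := greedy_free_set f ini Xinf IX' (ltini (h i0)).
exfalso; apply: big; apply: card_le_trans sqI.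
apply: (@card_le_trans _ _ _ (I `*` [set: Xi])); last exact: card_leX.
apply: (@card_le_trans _ _ _
  (\bigcup_(i in I) [set j | seg lt (h i0) j /\ ~ lt (h i) (h' j)])).
  apply: subset_card_le => j ji0; have [i Ii ji] := hcof (h' j).
  exists i => //; split=> // ij; have [_ tr _] := ltwo.
  by apply: (@wo_irr _ lt (h i) ltwo); exact: tr ij ji.
by apply: card_le_bigcup => i _; exact: hP'.
Qed.

(** * Many labels, pairwise not linked by the operators [F a] *)

Section TransfiniteConstruction.

Variables (X : Type) (F : X -> set X -> set X) (lt : X -> X -> Prop) (x0 : X).
Hypotheses (ini : initial_wo lt) (Xunc : ~ ([set: X] #<= [set: nat]))
  (Xpow : [set: nat -> X] #<= [set: X])
  (Fmono : forall a M M', M `<=` M' -> F a M `<=` F a M')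
  (Fcount : forall a M y, F a M y ->
    exists C, [/\ countable C, C `<=` M & F a C y]).

Let ltwo : wo lt. Proof. by case: ini. Qed.
Let ltwf : well_founded lt. Proof. by case: ltwo. Qed.
Let lttr x y z : lt x y -> lt y z -> lt x z. Proof. by case: ltwo => _ + _; apply. Qed.
Let lttot x y : [\/ lt x y, x = y | lt y x]. Proof. by case: ltwo. Qed.
Let ltirr x : ~ lt x x. Proof. exact: wo_irr. Qed.
Let nlt_trans x y z : ~ lt y x -> ~ lt z y -> ~ lt z x.
Proof.
move=> yx zy zx; have [yz|yz|//] := lttot y z; last by apply: yx; rewrite yz.
by apply: yx; exact: lttr yz zx.
Qed.

Let Xinf : infinite_set [set: X].
Proof. by move=> fin; apply: Xunc; exact: finite_set_countable. Qed.

(** * The tree of sequences of length below kappa *)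

Definition trim (g : X) (s : X -> X) : X -> X :=
  fun x => if pselect (lt x g) then s x else x0.

Lemma trimT g s x : lt x g -> trim g s x = s x.
Proof. by rewrite /trim; case: pselect. Qed.

Lemma trimF g s x : ~ lt x g -> trim g s x = x0.
Proof. by rewrite /trim; case: pselect. Qed.

Lemma trim_trim g g' s : ~ lt g' g -> trim g (trim g' s) = trim g s.
Proof.
move=> gg'; apply/funext => x; have [xg|nxg] := pselect (lt x g); last by rewrite !trimF.
by rewrite !trimT //; have [//|<-//|/gg'//] := lttot g g'; exact: lttr.
Qed.

Lemma trim_eq g s t : (forall x, lt x g -> s x = t x) -> trim g s = trim g t.
Proof.
move=> st; apply/funext => x; have [xg|nxg] := pselect (lt x g); last by rewrite !trimF.
by rewrite !trimT // st.
Qed.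

(** The sequences indexed by the elements below [g], coded as total functions with dummy value
    [x0]. *)
Definition trimmed g : set (X -> X) := [set s | trim g s = s].

Lemma trimmed_trim g s : trimmed g (trim g s).
Proof. by rewrite /trimmed /= trim_trim. Qed.

(* The levels below the least cardinal [kappa] with [X ^ kappa > X]; the
   labels are the branches, of length [kappa], of the tree of all [X]-valued
   sequences indexed by a level. *)
Definition level : set X := [set g | trimmed g #<= [set: X]].

Definition label : set (X -> X) := [set A | forall x, ~ level x -> A x = x0].

Lemma level_lt g g' : level g -> lt g' g -> level g'.
Proof.
move=> Kg g'g; apply: card_le_trans Kg; apply: subset_card_le => s ss.
rewrite /trimmed /= -[s in RHS]ss; apply/funext => x.
have [xg|nxg] := pselect (lt x g); first by rewrite trimT // ss.
by rewrite !trimF // => /lttr /(_ g'g).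
Qed.

Lemma card_pow_gt : ~ ([set: X -> X] #<= [set: X]).
Proof.
move=> /(card_leE x0)[e [_ einj]].
have /choice[Phi PhiP] : forall x, exists s, forall t, e t = x -> s = t.
  move=> x; have [[t <-]|nt] := pselect (exists t, e t = x).
    by exists t => t' /einj ->.
  by exists (fun=> x0) => t et; case: nt; exists t.
have /choice[d dP] : forall x, exists y, y <> Phi x x.
  move=> x; apply: contrapT => /forallNP h; apply: Xinf.
  apply: (@sub_finite_set _ _ [set Phi x x]); last exact: finite_set1.
  by move=> y _; apply: contrapT => /h.
by apply: (dP (e d)); rewrite (PhiP _ d).
Qed.

(** All sequences trimmed at the least [g] that is not a level are labels; if there is no such [g],
    every function is a label. *)
Lemma card_label : ~ (label #<= [set: X]).
Proof.
have [[g0 ng0]|allK] := pselect (exists g, ~ level g); last first.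
  move=> h; apply: card_pow_gt; apply: card_le_trans h; apply: subset_card_le.
  by move=> A _ x nKx; case: allK; exists x.
have [g ng gmin] := @wf_minP _ lt (fun g => ~ level g) ltwf (ex_intro (fun g => ~ level g) g0 ng0).
move=> h; apply: ng; apply: card_le_trans h; apply: subset_card_le => A AA x nKx.
rewrite -AA trimF // => xg; exact: (gmin x).
Qed.

(** König's diagonal argument: if [h] were unbounded, [d x] could avoid coordinate [x] of the fewer
    than |X| sequences with code at most [h x], and [trim g d] would have no code. *)
Lemma level_bound g (h : X -> X) : level g -> exists b, forall x, lt x g -> lt (h x) b.
Proof.
move=> /(card_leE x0)[e [_ einj]]; apply: contrapT => /forallNP nb.
have /choice[Phi PhiP] : forall x, exists s, forall t, trimmed g t -> e t = x -> s = t.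
  move=> x; have [[t tg <-]|nt] := pselect (exists2 t, trimmed g t & e t = x).
    by exists t => t' tg' /einj ->.
  by exists (fun=> x0) => t tg et; case: nt; exists t.
have /choice[d dP] : forall x, exists y, forall w, ~ lt (h x) w -> y <> Phi w x.
  move=> x; apply: contrapT => /forallNP hx.
  apply: (@card_segU1 _ lt (h x) Xinf ini).
  apply: (@card_le_surj _ _ _ _ (fun w => Phi w x)) => y _.
  have /existsNP[w /not_implyP[hw /contrapT ->]] := hx y.
  by exists w => //; have [hw'|->|wh] := lttot (h x) w; [case: hw|right|left].
have /existsNP[x /not_implyP[xg hx]] := nb (e (trim g d)).
by apply: (dP x _ hx); rewrite (PhiP _ (trim g d)) ?trimT //; exact: trimmed_trim.
Qed.

(** Otherwise countably many trims, together with the values [A (u n)] at which they stop, would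
    determine a label [A], leaving at most |X| labels. *)
Lemma level_seq_bound (u : nat -> X) : (forall n, level (u n)) ->
  exists g, level g /\ forall n, lt (u n) g.
Proof.
move=> uK; apply: contrapT => /forallNP nb; apply: card_label.
have /choice[e eP] : forall n, exists e : (X -> X) -> X,
    forall s t, trimmed (u n) s -> trimmed (u n) t -> e s = e t -> s = t.
  by move=> n; have [e [_ einj]] := card_leE x0 (uK n); exists e.
apply: card_le_trans (card_sq Xinf); apply: card_le_trans (card_leX Xpow Xpow).
apply: (@card_le_fun _ _ _ _
  (fun A => (fun n => e n (trim (u n) A), fun n => A (u n)))) => //.
move=> A B AL BL [eAB vAB]; apply/funext => x.
have [Kx|nKx] := pselect (level x); last by rewrite AL // BL.
have [n nx] : exists n, ~ lt (u n) x.
  by apply/existsNP => ux; apply: (nb x).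
have trimAB : trim (u n) A = trim (u n) B.
  apply: eP; [exact: trimmed_trim|exact: trimmed_trim|].
  exact: (congr1 (@^~ n) eAB).
have [xu|->|/nx//] := lttot x (u n); last exact: (congr1 (@^~ n) vAB).
by rewrite -(trimT A xu) trimAB trimT.
Qed.

Lemma level_nonempty : level !=set0.
Proof.
apply/set0P/eqP => K0; apply: card_label; apply: (@card_le_trans _ _ _ [set x0]).
  apply: (@card_le_fun _ _ _ _ (fun=> x0)) => // A B AL BL _; apply/funext => x.
  by rewrite AL ?BL ?K0.
exact: card_leT.
Qed.

Lemma level_above g g' : level g -> level g' -> exists h, [/\ level h, lt g h & lt g' h].
Proof.
move=> Kg Kg'; have [|h [Kh hP]] := @level_seq_bound (fun n => if n is 0 then g else g').
  by case.
by exists h; split => //; [exact: (hP 0)|exact: (hP 1)].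
Qed.

Definition node : set (X * (X -> X)) := [set v | level v.1 /\ trimmed v.1 v.2].

Lemma card_node : node #<= [set: X].
Proof.
apply: card_le_trans (card_sq Xinf).
apply: (@card_le_trans _ _ _ (level `*` [set: X])); last first.
  by apply: card_leX => //; exact: card_leT.
apply: (@card_le_trans _ _ _
  (\bigcup_(g in level) [set v : X * (X -> X) | v.1 = g /\ trimmed g v.2])).
  by apply: subset_card_le => -[g s] [/= Kg sg]; exists g.
apply: card_le_bigcup => g Kg; apply: card_le_trans Kg.
apply: (@card_le_fun _ _ _ _ snd) => [[g' s] [] //|[g1 s] [g2 t]].
by move=> [/= -> _] [/= -> _] ->.
Qed.

Definition on_branch (A : X -> X) (v : X * (X -> X)) := trim v.1 A = v.2.

Definition incompatible (v w : X * (X -> X)) :=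
  exists x, [/\ lt x v.1, lt x w.1 & v.2 x <> w.2 x].

Lemma incompatible_off_branch A v w :
  on_branch A v -> incompatible w v -> ~ on_branch A w.
Proof. by move=> Av [x [xw xv wv]] Aw; apply: wv; rewrite -Aw -Av !trimT. Qed.

Lemma off_branch A v : trimmed v.1 v.2 -> ~ on_branch A v ->
  exists2 x, lt x v.1 & v.2 x <> A x.
Proof.
move=> vt nAv; apply: contrapT => /forall2NP h; apply: nAv.
rewrite /on_branch -vt; apply: trim_eq => x xv.
by have [//|/contrapT] := h x.
Qed.

(** Were [w] no longer than [v], its agreement with [v] would put it on [A]. *)
Lemma compatible_off_branch A v w : trimmed w.1 w.2 -> on_branch A v ->
  ~ on_branch A w -> ~ incompatible w v -> lt v.1 w.1 /\ trim v.1 w.2 = v.2.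
Proof.
move=> wt Av nAw ncomp.
have agree x : lt x w.1 -> lt x v.1 -> w.2 x = v.2 x.
  by move=> xw xv; apply: contrapT => wv; apply: ncomp; exists x.
have vw : lt v.1 w.1.
  apply: contrapT => nvw; have [x xw wAx] := off_branch wt nAw; apply: wAx.
  have xv : lt x v.1.
    by have [/nvw//|vw|] := lttot v.1 w.1; [rewrite vw|exact: lttr].
  by rewrite agree // -Av trimT.
split=> //; rewrite -[RHS]Av; apply: trim_eq => x xv.
by rewrite agree // -?Av ?trimT //; exact: lttr vw.
Qed.

(** * The recursion over tasks *)

Section Recursion.

Variables (Th : Type) (ltT : Th -> Th -> Prop) (a : Th -> X) (v : Th -> X * (X -> X)).
Hypotheses (ltTwo : wo ltT) (ltTsmall : forall t, ~ ([set: X] #<= seg ltT t)).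

(* Stage [t] faces the code [a t] and the node [v t], and returns [(y, q, b)]
   with [y] a fresh point. If [b], the points of [q] enter every [member A] and
   [y] enters none, although [y] lies in [F (a t) (member A)] for each [A]
   through [v t]. If not [b], then [y] enters [member A] exactly for the [A] off
   [v t], and no countable set compatible with what is decided for the branches
   through [v t] could have produced a fresh point. *)
Let outcome : Type := X * set X * bool.

Definition decided (o : Th -> outcome) (t : Th) : set X :=
  [set z | exists s, ltT s t /\ (z = (o s).1.1 \/ (o s).1.2 z)].

(* The points known at stage [t] to enter [member A] for every [A] through [v t]. *)
Definition core (o : Th -> outcome) (t : Th) : set X :=
  [set z | exists s, ltT s t /\ ((o s).1.2 z \/
    [/\ ~~ (o s).2, z = (o s).1.1 & incompatible (v s) (v t)])].

(** The decided points of [p] already lie in every member through [v t], so the rest of [p] can be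
    added to all of these; [~ p y] allows [y] to be kept out. *)
Definition overflow (o : Th -> outcome) (t : Th) (y : X) (p : set X) :=
  [/\ countable p, ~ decided o t y, ~ p y, p `&` decided o t `<=` core o t & F (a t) p y].

Definition diagonalizes (o : Th -> outcome) := forall t,
  [/\ ~ decided o t (o t).1.1,
      forall z, (o t).1.2 z -> ~ decided o t z /\ z <> (o t).1.1,
      (o t).2 -> exists p, F (a t) p (o t).1.1 /\
        forall z, p z -> core o t z \/ (o t).1.2 z &
      ~~ (o t).2 -> forall y p, ~ overflow o t y p].

Lemma recursion_exists : exists o, diagonalizes o.
Proof.
have [Twf Ttr Ttot] := ltTwo.
(* Countability of the added set keeps the decided points few. The last clause is conditional
   because an arbitrary history [h] may have decided everything. *)
pose P t (h : Th -> outcome) (w : outcome) := [/\ countable w.1.2,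
  w.2 -> exists p, overflow h t w.1.1 p /\ w.1.2 = p `\` decided h t &
  ~~ w.2 -> [/\ w.1.2 = set0, forall y p, ~ overflow h t y p &
     (exists z, ~ decided h t z) -> ~ decided h t w.1.1]].
have [||o oP] := @wf_choice Th outcome ltT P (x0, set0, true) Twf.
- move=> t h h' w hh'.
  have decE : decided h t = decided h' t.
    by apply/seteqP; split=> z [s [st zs]]; exists s; split => //; move: zs; rewrite hh'.
  have coreE : core h t = core h' t.
    by apply/seteqP; split=> z [s [st zs]]; exists s; split => //; move: zs; rewrite hh'.
  by rewrite /P /overflow decE coreE.
- move=> t h; have [[y [p yp]]|nov] := pselect (exists y p, overflow h t y p).
    exists (y, p `\` decided h t, true); split => //=.
      by have [pc _ _ _ _] := yp; apply: sub_countable pc; exact: card_le_setD.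
    by move=> _; exists p.
  have [[z nz]|nz] := pselect (exists z, ~ decided h t z).
    exists (z, set0, false); split => //= _; split => // y p yp.
    by apply: nov; exists y, p.
  exists (x0, set0, false); split => //= _; split => // y p yp.
  by apply: nov; exists y, p.
exists o => t.
(* Fewer than |X| earlier stages decide countably many points each. *)
have fresh : exists z, ~ decided o t z.
  apply: contrapT => /forallNP all; apply: (card_nle_X Xinf (@ltTsmall t) Xunc).
  apply: (@card_le_trans _ _ _
    (\bigcup_(s in seg ltT t) ([set (o s).1.1] `|` (o s).1.2))).
    apply: subset_card_le => z _; have /contrapT[s [st zs]] := all z.
    by exists s.
  apply: card_le_bigcup => s _; have [qc _ _] := oP s.
  by rewrite -/(countable _) -bigcup2E; apply: bigcup_countable => // -[|[|i]] _ /=.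
have [_ o1 o2] := oP t; case b : (o t).2 o1 o2.
  move=> /(_ isT)[p [[pc ny py pcore Fp] qE]] _; split=> //.
    by move=> z; rewrite qE => -[pz nz]; split => // zy; apply: py; rewrite -zy.
  move=> _; exists p; split => // z pz.
  have [dz|ndz] := pselect (decided o t z); first by left; apply: pcore.
  by right; rewrite qE.
move=> _ /(_ isT)[q0 nov /(_ fresh) ny]; split => // z.
by rewrite q0.
Qed.

Variable o : Th -> outcome.
Hypothesis oP : diagonalizes o.

Definition member (A : X -> X) : set X :=
  [set z | exists t, (o t).1.2 z \/
    [/\ ~~ (o t).2, z = (o t).1.1 & ~ on_branch A (v t)]].

(** A stage acts only on points undecided so far, so neither [t] nor a later stage can account for
    [z]. *)
Lemma member_decided A t z : member A z -> decided o t z ->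
  exists s, ltT s t /\ ((o s).1.2 z \/
    [/\ ~~ (o s).2, z = (o s).1.1 & ~ on_branch A (v s)]).
Proof.
have [_ Ttr Ttot] := ltTwo.
move=> [s zs] dz; exists s; split=> //; apply: contrapT => nst.
have {nst} [r rs zr] : exists2 r, ltT r s & z = (o r).1.1 \/ (o r).1.2 z.
  move: dz => [r [rt zr]]; exists r => //.
  by have [/nst//|->//|ts] := Ttot s t; exact: Ttr rt ts.
have [ny nq _ _] := oP s; case: zs => [/nq[nz _]|[_ zy _]].
  by apply: nz; exists r.
by apply: ny; exists r; rewrite -zy.
Qed.

Lemma member_new A t : member A (o t).1.1 -> ~~ (o t).2 /\ ~ on_branch A (v t).
Proof.
have [_ Ttr Ttot] := ltTwo; have [nyt nqt _ _] := oP t.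
move=> [s ys]; have [st|ts|ts] := Ttot s t.
- by case: nyt; exists s; split=> //; case: ys => [ys|[_ ys _]]; [right|left].
- by move: ys; rewrite ts => -[/nqt[]//|[]].
- have [nys nqs _ _] := oP s; case: ys => [/nqs[nd _]|[_ ys _]].
    by case: nd; exists t; split => //; left.
  by case: nys; exists t; split => //; left.
Qed.

Lemma core_member A t z : on_branch A (v t) -> core o t z -> member A z.
Proof.
move=> At [s [st [qz|[bs zs inc]]]]; exists s; first by left.
by right; split => //; exact: incompatible_off_branch At inc.
Qed.

(** An overflow at [t] would have put [p] into [member A'], so [F (a t)] would produce the excluded
    point [(o t).1.1]. *)
Lemma transfer_no_overflow A A' t : on_branch A' (v t) ->
  F (a t) (member A') = member A -> ~~ (o t).2.
Proof.
move=> A't FA; apply/negP => bt; have [_ _ /(_ bt)[p [Fp pP]] _] := oP t.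
have /member_new[] : member A (o t).1.1; last by rewrite bt.
rewrite -FA; apply: Fmono Fp => z /pP[/core_member|qz]; first exact.
by exists t; left.
Qed.

Lemma transfer_witness A A' t : on_branch A' (v t) -> ~ on_branch A (v t) ->
  F (a t) (member A') = member A ->
  exists p, [/\ countable p, p `<=` member A', ~ p (o t).1.1 & F (a t) p (o t).1.1].
Proof.
move=> A't nAt FA; have bt := transfer_no_overflow A't FA.
have yA : member A (o t).1.1 by exists t; right.
move: yA; rewrite -FA => /Fcount[p [pc pM Fp]]; exists p; split => //.
by move=> /pM /member_new[].
Qed.

(** With no overflow at [t], some decided point of [p] is outside the core; it can be in [member A']
    only as the point of an earlier stage of the kind described. *)
Lemma transfer_obstruction A A' t y p : on_branch A' (v t) ->
  F (a t) (member A') = member A ->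
  countable p -> p `<=` member A' -> ~ decided o t y -> ~ p y -> F (a t) p y ->
  exists s, [/\ ltT s t, p (o s).1.1, ~ on_branch A' (v s) & ~ incompatible (v s) (v t)].
Proof.
move=> A't FA pc pM ny npy Fp; apply: contrapT => /forallNP ns.
have [_ _ _ /(_ (transfer_no_overflow A't FA) y p)] := oP t; apply; split => // z [pz dz].
have [s [st [qz|[bs zs nAs]]]] := member_decided (pM _ pz) dz; exists s; split => //.
  by left.
right; split => //; apply: contrapT => ninc; apply: (ns s); split => //.
by rewrite -zs.
Qed.

Lemma new_undecided s t : ~ ltT t s -> ~ decided o s (o t).1.1.
Proof.
have [_ Ttr Ttot] := ltTwo => nts [r [rs yr]]; have [ny _ _ _] := oP t.
apply: ny; exists r; split => //; have [st|<-//|/nts//] := Ttot s t.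
exact: Ttr rs st.
Qed.

Lemma new_inj s t : (o s).1.1 = (o t).1.1 -> s = t.
Proof.
have [_ Ttr Ttot] := ltTwo => st; have [lst|//|lts] := Ttot s t.
  by have [ny _ _ _] := oP t; case: ny; exists s; split => //; left.
by have [ny _ _ _] := oP s; case: ny; exists t; split => //; left.
Qed.

End Recursion.

Lemma label_diff A A' : label A -> label A' -> A <> A' ->
  exists2 d, level d & forall g, lt d g -> ~ on_branch A (g, trim g A').
Proof.
move=> AL AL' nAA'; apply: contrapT => /forall2NP h; apply: nAA'.
apply/funext => x; have [Kx|nKx] := pselect (level x); last by rewrite AL // AL'.
have [//|] := h x; apply: contra_notP => nx g xg Ag; apply: nx.
by have := congr1 (@^~ x) Ag; rewrite /= !trimT.
Qed.

Lemma card_task : [set: X] `*` node #<= [set: X].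
Proof.
apply: card_le_trans (card_sq Xinf).
by apply: card_leX => //; exact: card_node.
Qed.

(* First schedule, for [cf |X| <> kappa]: every task recurs unboundedly often,
   so some level bounds the supports of cofinally many countable witnesses. *)
Lemma free_labels_recurrent :
  (forall g : X -> X, (forall x, level (g x)) -> exists g1, level g1 /\
     forall h, exists x, lt h x /\ ~ lt g1 (g x)) ->
  exists M : (X -> X) -> set X, forall A A', label A -> label A' -> A <> A' ->
    forall a, F a (M A') <> M A.
Proof.
move=> pos; have [l0 Kl0] := level_nonempty.
(* The first component is padding that repeats each task |X| times. *)
have [e einj] : exists e : X * (X * (X * (X -> X))) -> X,
    forall x w x' w', node w.2 -> node w'.2 -> e (x, w) = e (x', w') -> x = x' /\ w = w'.
  have [|e [_ einj]] := @card_leE _ _ ([set: X] `*` ([set: X] `*` node)) [set: X] x0.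
    apply: card_le_trans (card_sq Xinf).
    by apply: card_leX => //; exact: card_task.
  exists e => x w x' w' nw nw' /einj.
  by move=> /(_ (conj I (conj I nw)) (conj I (conj I nw')))[-> ->].
have /choice[task taskP] : forall t, exists w : X * (X * (X -> X)), node w.2 /\
    forall x w', node w'.2 -> e (x, w') = t -> w' = w.
  move=> t; have [[x [w [nw <-]]]|nt] :=
      pselect (exists x w, node w.2 /\ e (x, w) = t).
    by exists w; split => // x' w' nw' /einj[].
  exists (x0, (l0, trim l0 (fun=> x0))); split.
    by split => //; exact: trimmed_trim.
  by move=> x w nw et; case: nt; exists x, w; split.
have recur w h : node w.2 -> exists t, ~ lt t h /\ task t = w.
  move=> nw; apply: contrapT => /forallNP nt.
  apply: (ini.2 h); apply: (@card_le_fun _ _ _ _ (fun x => e (x, w))).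
    move=> x _; apply: contrapT => nxh; apply: (nt (e (x, w))); split=> //.
    by have [_ /(_ x w nw erefl)] := taskP (e (x, w)).
  by move=> x y _ _ /einj[].
have [o oP] := recursion_exists (fun t => (task t).1) (fun t => (task t).2) ltwo ini.2.
exists (member (fun t => (task t).2) o) => A A' AL AL' nAA' a FA.
have [d Kd dP] := label_diff AL AL' nAA'.
have [g0 [Kg0 dg0 _]] := level_above Kd Kd.
have branchP g : level g -> node (g, trim g A') /\ on_branch A' (g, trim g A').
  by move=> Kg; split => //; split => //; exact: trimmed_trim.
have /choice[th thP] := fun h => recur (a, (g0, trim g0 A')) h (branchP _ Kg0).1.
have /choice[p pP] : forall x, exists p, [/\ countable p,
    p `<=` member (fun t => (task t).2) o A', ~ p (o (th x)).1.1 &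
    F a p (o (th x)).1.1].
  move=> x; have [_ tx] := thP x.
  have := @transfer_witness X lt _ _ ltwo o oP A A' (th x); rewrite tx /=; apply.
  - exact: (branchP _ Kg0).2.
  - exact: dP.
  - exact: FA.
(* Below level [g x], every node off [A'] whose point lies in [p x] has already left [A']. *)
have /choice[g gP] : forall x, exists g, level g /\ forall s, p x (o s).1.1 ->
    ~ on_branch A' (task s).2 ->
    exists2 w, lt w g & lt w (task s).2.1 /\ (task s).2.2 w <> A' w.
  move=> x; have [pc _ _ _] := pP x.
  have [f fP] : exists f : nat -> X, forall z, p x z -> exists n, f n = z.
    have [->|/set0P[z0 pz0]] := eqVneq (p x) set0; first by exists (fun=> x0).
    have [c [_ cinj]] := card_leE 0 pc.
    have /choice[f fP] : forall n, exists z, forall z', p x z' -> c z' = n -> z' = z.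
      move=> n; have [[z [pz <-]]|nz] := pselect (exists z, p x z /\ c z = n).
        by exists z => z' pz' /cinj ->.
      by exists x0 => z pz cz; case: nz; exists z.
    by exists f => z pz; exists (c z); rewrite -(fP (c z) z).
  have /choice[u uP] : forall n, exists w, level w /\ forall s, f n = (o s).1.1 ->
      ~ on_branch A' (task s).2 ->
      lt w (task s).2.1 /\ (task s).2.2 w <> A' w.
    move=> n; have [[s [fs nbs]]|ns] := pselect (exists s,
        f n = (o s).1.1 /\ ~ on_branch A' (task s).2); last first.
      by exists l0; split => // s fs nbs; case: ns; exists s.
    have [[Ks ts] _] := taskP s.
    have [w ws wA] := off_branch ts nbs; exists w; split.
      exact: level_lt Ks ws.
    move=> s' fs'; have -> // : s' = s.
    by apply: (new_inj ltwo oP); rewrite -fs.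
  have [g [Kg gu]] := level_seq_bound (fun n => (uP n).1).
  exists g; split=> // s ps nbs; have [n fn] := fP _ ps.
  have [_ /(_ s fn nbs)] := uP n; exists (u n) => //; exact: gu.
have [g1 [Kg1 g1P]] := pos g (fun x => (gP x).1).
(* A stage for [a] and the node of [A'] at [g1]. It precedes some [th x] with [g x] at most [g1], so
   no obstruction remains. *)
have [t [_ tt]] := recur (a, (g1, trim g1 A')) x0 (branchP _ Kg1).1.
have [x [tx gx]] := g1P t.
have [pc pM npy Fp] := pP x.
have := @transfer_obstruction X lt _ _ ltwo o oP A A' t (o (th x)).1.1 (p x).
rewrite tt /= => /(_ (branchP _ Kg1).2 FA pc pM) [||//|s [st ps nbs ncomp]].
- apply: (new_undecided ltwo oP); have [nthx _] := thP x.
  move=> tht; apply: nthx; exact: lttr tht tx.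
- exact: npy.
have [_ /(_ s ps nbs)[w wg [ws wA]]] := gP x.
apply: ncomp; exists w => /=; have wg1 : lt w g1.
  by have [/gx//|->//|] := lttot g1 (g x); exact: lttr.
by split => //; rewrite trimT.
Qed.

(* Second schedule, for [cf |X| = kappa]: each code is attached to a final
   segment of the levels, so that only fewer than [|X|] codes are attached to a
   given level, and the tasks of a node precede those of its extensions. *)
Lemma free_labels_layered (g0 : X -> X) : (forall x, level (g0 x)) ->
  (forall g, level g -> exists h, forall x, lt h x -> lt g (g0 x)) ->
  exists M : (X -> X) -> set X, forall A A', label A -> label A' -> A <> A' ->
    forall a, F a (M A') <> M A.
Proof.
move=> Kg0 neg.
have [e' [_ einj']] := card_leE x0 card_node.
have [e [_ einj]] := card_leE x0 card_task.
have /choice[bd bdP] : forall g, exists h, level g -> forall x, lt h x -> lt g (g0 x).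
  move=> g; have [Kg|nKg] := pselect (level g); last by exists x0.
  by have [h hP] := neg _ Kg; exists h.
(* Here [b] bounds the codes of all restrictions of [v] and the points past which [g0] exceeds their
   levels; the least such [b] does not decrease along extensions. *)
pose bounds (v : X * (X -> X)) b := forall x, ~ lt v.1 x ->
  ~ lt b (e' (x, trim x v.2)) /\ ~ lt b (bd x).
have /choice[rho rhoP] : forall v, exists b, node v ->
    bounds v b /\ forall b', bounds v b' -> ~ lt b' b.
  move=> v; have [nv|nnv] := pselect (node v); last by exists x0.
  have [g [Kg vg _]] := level_above nv.1 nv.1.
  have [b1 b1P] := level_bound (fun x => e' (x, trim x v.2)) Kg.
  have [b2 b2P] := level_bound bd Kg.
  have [b [b1b b2b]] : exists b, ~ lt b b1 /\ ~ lt b b2.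
    have [b12|->|b21] := lttot b1 b2.
    - by exists b2; split; [move=> /(lttr b12)|]; exact: ltirr.
    - by exists b2; split; exact: ltirr.
    - by exists b1; split; [|move=> /(lttr b21)]; exact: ltirr.
  have [|b' bb' bmin] := @wf_minP _ lt (bounds v) ltwf; last by exists b'.
  exists b => x vx; have xg : lt x g.
    by have [/vx//|<-//|xv] := lttot v.1 x; exact: lttr xv vg.
  split=> [bx|bx].
    by apply: b1b; apply: lttr bx _; exact: b1P.
  by apply: b2b; apply: lttr bx _; exact: b2P.
have rho_mono v w : node v -> node w -> lt v.1 w.1 -> trim v.1 w.2 = v.2 ->
    ~ lt (rho w) (rho v).
  move=> nv nw vw wv; have [_ vmin] := rhoP _ nv; apply: vmin => x vx.
  have [wb _] := rhoP _ nw; have nwx : ~ lt w.1 x by move=> /(lttr vw)/vx.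
  by have := wb _ nwx; rewrite -wv trim_trim.
pose Th := {w : X * (X * (X -> X)) | `[< node w.2 /\ ~ lt w.2.1 (g0 w.1) >]}.
have Thnode (t : Th) : node (val t).2 by case: t => w /= /asboolP[].
(* Ties in [rho] are broken by the level, so that proper extensions come later. *)
pose key (t : Th) := (rho (val t).2, ((val t).2.1, e (val t))).
pose ltT (s t : Th) := slexprod X (X * X) lt (slexprod X X lt lt) (key s) (key t).
have ltTwo : wo ltT.
  apply: (@wo_preim _ _ _ key); first by apply: (wo_lex ltwo); exact: wo_lex.
  move=> s t /(congr1 (fun k => k.2.2)) /einj est; apply: val_inj; apply: est.
    by split => //; exact: Thnode.
  by split => //; exact: Thnode.
have ltTsmall t : ~ ([set: X] #<= seg ltT t).
  pose r := rho (val t).2; pose R := seg lt r `|` [set r].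
  have RP x : ~ lt r x -> R x.
    by move=> rx; have [/rx//|<-|xr] := lttot r x; [right|left].
  have XR : ~ ([set: X] #<= R) by exact: card_segU1.
  (* The operator code of an earlier task is at most [bd] of its level, so it and the code of the
     node both lie in [R]. *)
  move=> XT; apply: (card_nle_X Xinf XR XR); apply: (card_le_trans XT).
  apply: (@card_le_fun _ _ _ _ (fun s : Th => ((val s).1, e' (val s).2))); last first.
    move=> s s' _ _ [s1 /einj' s2]; apply: val_inj.
    by apply: injective_projections => //; apply: s2; exact: Thnode.
  move=> s st; have rs : ~ lt r (rho (val s).2).
    have [/= sr /(lttr sr)/ltirr//|[/= -> _]] := slexprodE st; exact: ltirr.
  have [sb _] := rhoP _ (Thnode s).
  have [b1 b2] := sb _ (@ltirr _).
  rewrite (Thnode s).2 -surjective_pairing in b1.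
  split=> /=; apply: RP; apply: nlt_trans rs => //; apply: nlt_trans b2.
  by move=> /(bdP _ (Thnode s).1); case: s {st sb b1} => w /= /asboolP[].
have [o oP] := recursion_exists (fun t : Th => (val t).1) (fun t => (val t).2) ltTwo ltTsmall.
exists (member (fun t : Th => (val t).2) o) => A A' AL AL' nAA' a FA.
have [d Kd dP] := label_diff AL AL' nAA'.
have [g [Kg dg ag]] := level_above Kd (Kg0 a).
have tP : `[< node (g, trim g A') /\ ~ lt g (g0 a) >].
  apply/asboolP; split; first by split => //; exact: trimmed_trim.
  by move=> /(lttr ag); exact: ltirr.
pose t : Th := exist _ (a, (g, trim g A')) tP.
have [p [pc pM npy Fp]] := @transfer_witness _ _ _ _ ltTwo o oP A A' t
  erefl (dP _ dg) FA.
have nyt := new_undecided ltTwo oP (@wo_irr _ _ t ltTwo).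
have [s [st _ nbs ncomp]] := @transfer_obstruction _ _ _ _ ltTwo o oP A A' t _ p
  erefl FA pc pM nyt npy Fp.
(* The node of [s] properly extends that of [t], so [s] cannot precede [t]. *)
have [ts tsE] := compatible_off_branch (Thnode s).2 (erefl : on_branch A' (val t).2) nbs ncomp.
have nst := rho_mono _ _ (Thnode t) (Thnode s) ts tsE.
have [/nst//|[_ /slexprodE[/= sg|[/= sg _]]]] := slexprodE st.
  exact: ltirr (lttr ts sg).
by move: ts; rewrite sg; exact: ltirr.
Qed.

Lemma free_labels : exists M : (X -> X) -> set X,
  forall A A', label A -> label A' -> A <> A' -> forall a, F a (M A') <> M A.
Proof.
have [pos|] := pselect (forall g : X -> X, (forall x, level (g x)) ->
    exists g1, level g1 /\ forall h, exists x, lt h x /\ ~ lt g1 (g x)).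
  exact: free_labels_recurrent.
move=> /existsNP[g0 /not_implyP[Kg0 ng0]]; apply: (free_labels_layered Kg0) => g Kg.
apply: contrapT => /forallNP nh; apply: ng0; exists g; split => // h.
apply: contrapT => /forallNP nx; apply: (nh h) => x hx.
by apply: contrapT => ngx; apply: (nx x).
Qed.

End TransfiniteConstruction.

(** By [Fid], distinct labels give distinct sets, so there are more than |X| of these. If they are
    fewer than the subsets of [X], they serve as colours in Hajnal's theorem. *)
Lemma large_free_family X (F : X -> set X -> set X) :
  ~ ([set: X] #<= [set: nat]) -> [set: nat -> X] #<= [set: X] ->
  (forall a M M', M `<=` M' -> F a M `<=` F a M') ->
  (forall a M y, F a M y -> exists C, [/\ countable C, C `<=` M & F a C y]) ->
  (forall M, exists a, F a M = M) ->
  exists Y : set (set X), Y #= [set: set X] /\ free_set F Y.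
Proof.
move=> Xunc Xpow Fmono Fcount Fid.
have Xinf : infinite_set [set: X].
  by move=> fin; apply: Xunc; exact: finite_set_countable.
have [x0 _] := infinite_setN0 Xinf.
have [lt ini] := initial_wo_exists X.
have [M MP] := free_labels x0 ini Xunc Xpow Fmono Fcount.
pose I := [set M A | A in label lt x0].
have Minj A A' : label lt x0 A -> label lt x0 A' -> M A = M A' -> A = A'.
  move=> AL AL' MAA'; apply: contrapT => nAA'; have [a Fa] := Fid (M A').
  by apply: (MP _ _ AL AL' nAA' a); rewrite MAA'.
have nIX : ~ (I #<= [set: X]).
  move=> IX; apply: (@card_label X lt x0 ini Xunc).
  apply: card_le_trans IX; apply: (@card_le_fun _ _ _ _ M) => [A AL|A A' AL AL'].
    by exists A.
  exact: Minj.
have Ifree : free_set F I.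
  move=> _ _ [A AL <-] [A' AL' <-] nAA' a; apply: MP => // AA'.
  by apply: nAA'; rewrite AA'.
have [Y [LY Yfree]] : exists Y : set (set X), [set: set X] #<= Y /\ free_set F Y.
  have [LI|nLI] := pselect ([set: set X] #<= I); first by exists I.
  exact: large_free_set nIX nLI.
by exists Y; split => //; rewrite card_eq_le LY card_leT.
Qed.

(** * Tukey quotients between posets of trees *)

Section TreePosets.

Local Open Scope order_scope.

(* The subsets of the binary tree are coded as elements of [pow_omega] through
   [pickle]; only the codes of finite sequences matter. *)
Definition pref (x : pow_omega) (n : nat) : nat := pickle (mkseq x n).

Definition is_tree (p : pow_omega) :=
  forall x m n, (m <= n)%N -> p (pref x n) -> p (pref x m).

Definition branches (p : pow_omega) : set pow_omega := [set x | forall n, p (pref x n)].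

Definition trees (M : set pow_omega) : set pow_omega :=
  [set p | [/\ is_tree p, countable (branches p) & branches p `<=` M]].

Lemma pow_leP (p q : pow_omega) : p <= q <-> forall n, p n -> q n.
Proof.
split=> [/lefP pq n pn|pq]; first by have := pq n; rewrite pn; case: (q n).
by apply/lefP => n; have := pq n; case: (p n) => [->|].
Qed.

(* A branch of the union of [p] and the [q k] that is not a branch of [p] leaves
   [p], hence all but finitely many [q k]. *)
Lemma trees_limit_bounded M p (q : nat -> pow_omega) :
  trees M p -> (forall k, trees M (q k)) ->
  (forall k c, (c < k)%N -> q k c = p c) ->
  exists r, [/\ trees M r, p <= r & forall k, q k <= r].
Proof.
move=> [ptree pcount pM] qM qp.
exists (fun c => `[< p c \/ exists k, q k c >]); split; last first.
- by move=> k; apply/pow_leP => n qn; apply/asboolP; right; exists k.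
- by apply/pow_leP => n pn; apply/asboolP; left.
suff sub : branches (fun c => `[< p c \/ exists k, q k c >]) `<=`
    branches p `|` \bigcup_k branches (q k).
  split.
  - move=> x m n mn /asboolP[pn|[k qn]]; apply/asboolP.
      by left; exact: ptree pn.
    by right; exists k; have [qtree _ _] := qM k; exact: qtree qn.
  - apply: sub_countable (subset_card_le sub) _.
    rewrite -bigcup2E; apply: bigcup_countable => // -[|[|i]] _ //=.
    by apply: bigcup_countable => // k _; have [] := qM k.
  - move=> x /sub[/pM//|[k _]]; have [_ _] := qM k; exact.
move=> x rx; have [px|/existsNP[j npj]] := pselect (branches p x); first by left.
right; apply: contrapT => nqx.
have nq k : exists i, ~ q k (pref x i).
  by apply/existsNP => qx; apply: nqx; exists k.
have /choice[i iP] := nq.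
(* At depth [m], [x] has left [p] and every [q k] with [k <= b]; for [k > b], [q k] agrees with [p]
   at the code [pref x j]. *)
pose b := (pref x j).+1; pose m := maxn j (\max_(k < b.+1) i k).
have /asboolP[pm|[k qm]] := rx m.
  by apply: npj; apply: ptree pm; exact: leq_maxl.
have [qtree _ _] := qM k; have [kb|bk] := leqP k b.
  apply: (iP k); apply: qtree qm; apply: leq_trans (leq_maxr _ _).
  exact: (@leq_bigmax _ (fun k : 'I_b.+1 => i k) (Ordinal (kb : (k < b.+1)%N))).
apply: npj; rewrite -(qp k) //; last exact: ltn_trans bk.
by apply: qtree qm; exact: leq_maxl.
Qed.

Lemma trees_directed M : directed (trees M).
Proof.
move=> p q pM qM.
(* The sequence [q, p, p, ...] converges to [p]. *)
have [|//|r [rM pr qr]] := @trees_limit_bounded M p (fun k => if k is 0 then q else p) pM.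
  by case.
  by case.
by exists r; split => //; exact: (qr 0).
Qed.

Lemma pref_inj x y n : pref x n = pref y n -> forall i, (i < n)%N -> x i = y i.
Proof.
move=> /(pcan_inj pickleK) xy i lin.
by rewrite -(nth_mkseq false x lin) xy nth_mkseq.
Qed.

Lemma eq_pref x y n : (forall i, (i < n)%N -> x i = y i) -> pref x n = pref y n.
Proof.
move=> xy; congr pickle; apply: (@eq_from_nth _ false); rewrite !size_mkseq //.
by move=> i lin; rewrite !nth_mkseq // xy.
Qed.

Definition singleton_tree (y : pow_omega) : pow_omega :=
  fun c => `[< exists n, c = pref y n >].

Lemma pref_size x m y n : pref x m = pref y n -> m = n.
Proof. by move=> /(pcan_inj pickleK)/(congr1 size); rewrite !size_mkseq. Qed.

Lemma branches_singleton y : branches (singleton_tree y) = [set y].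
Proof.
apply/seteqP; split=> [x xy|_ ->]; last by move=> n; apply/asboolP; exists n.
apply/funext => i; have /asboolP[n xn] := xy i.+1.
have nE := pref_size xn; rewrite -nE in xn.
exact: (pref_inj xn).
Qed.

Lemma singleton_treeP (M : set pow_omega) y : M y -> trees M (singleton_tree y).
Proof.
move=> My; split; rewrite ?branches_singleton //; last by move=> _ ->.
move=> x m n mn /asboolP[n' xy]; apply/asboolP; exists m.
have nE := pref_size xy; rewrite -nE in xy.
by apply: eq_pref => i im; apply: (pref_inj xy); exact: leq_trans mn.
Qed.

(* [code a] ranges over all sequences of pairs as [a] ranges over [pow_omega];
   [transfer a M] is the image of [trees M] under the closure of [code a]. *)
Definition code (a : pow_omega) (n : nat) : pow_omega * pow_omega :=
  (fun c => a (pickle (n, c, false)), fun c => a (pickle (n, c, true))).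

Lemma code_surj (u : nat -> pow_omega * pow_omega) : exists a, code a = u.
Proof.
exists (fun m => if unpickle m is Some (n, c, b) then
  if b then (u n).2 c else (u n).1 c else false).
apply/funext => n; rewrite /code; case E : (u n) => [v w].
by congr pair; apply/funext => c; rewrite pickleK E.
Qed.

Definition transfer (a : pow_omega) (M : set pow_omega) : set pow_omega :=
  [set y | exists2 p, trees M p & forall k, exists n,
    forall c, (c < k)%N -> (code a n).1 c = p c /\ (code a n).2 c = y c].

Lemma transfer_mono a M M' : M `<=` M' -> transfer a M `<=` transfer a M'.
Proof.
by move=> MM' y [p [pt pc pM] pa]; exists p => //; split => // x /pM/MM'.
Qed.

Lemma transfer_countable a M y : transfer a M y ->
  exists C, [/\ countable C, C `<=` M & transfer a C y].
Proof.
by move=> [p [pt pc pM] pa]; exists (branches p); split => //; exists p => //; split.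
Qed.

(** If no [psi q] existed, the [p] with [phi p] not above [q] would be cofinal, and so would their
    images, none of which is above [q]. *)
Lemma tukey_ge_witness d (T : porderType d) (P Q : set T) : tukey_ge P Q ->
  exists (phi psi : T -> T), [/\ forall p, P p -> Q (phi p),
    forall q, Q q -> P (psi q) &
    forall q p, Q q -> P p -> psi q <= p -> q <= phi p].
Proof.
move=> [phi phiP].
have /choice[psi psiP] : forall q, exists p, Q q ->
    P p /\ forall p', P p' -> p <= p' -> q <= phi p'.
  move=> q; apply: contrapT => nq.
  have {nq} [Qq nq] : Q q /\ forall p, P p -> exists p', [/\ P p', p <= p' & ~ q <= phi p'].
    split; first by apply: contrapT => nQq; apply: nq; exists q.
    move=> p Pp; apply: contrapT => np; apply: nq; exists p => _; split => // p' Pp' pp'.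
    by apply: contrapT => h; apply: np; exists p'.
  have [|_ /(_ _ Qq)[_ [p [Pp np] <-] //]] := phiP [set p | P p /\ ~ q <= phi p].
  split=> [p []//|p /nq[p' [Pp' pp' np']]]; by exists p'.
exists phi, psi; split => [p /(@funS _ _ _ _ phi)//|q /psiP[]//|q p Qq Pp].
by have [_] := psiP _ Qq; apply.
Qed.

(** For each pair of finite strings, pick a point of the graph of [f] over [N] that extends both, if
    there is one. *)
Lemma dense_sequence (N : set pow_omega) (f : pow_omega -> pow_omega) : N !=set0 ->
  exists u : nat -> pow_omega, (forall n, N (u n)) /\
    forall y k, N y -> exists n, forall c, (c < k)%N -> f (u n) c = f y c /\ u n c = y c.
Proof.
move=> [y0 Ny0].
pose near (st : seq bool * seq bool) y :=
  mkseq (f y) (size st.1) = st.1 /\ mkseq y (size st.2) = st.2.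
have /choice[u uP] : forall n, exists y, N y /\
    forall st, unpickle n = Some st -> (exists2 y', N y' & near st y') -> near st y.
  move=> n; case: (unpickle n) => [st|]; last by exists y0.
  have [[y' Ny' y'P]|ny] := pselect (exists2 y', N y' & near st y').
    by exists y'; split => // _ [<-].
  by exists y0; split => // _ [<-] /ny.
exists u; split=> [n|y k Ny]; first by have [] := uP n.
pose st := (mkseq (f y) k, mkseq y k).
exists (pickle st); have [_ /(_ st (pickleK st))[]] := uP (pickle st).
  by exists y => //; split; rewrite size_mkseq.
rewrite /st /= !size_mkseq => f1 f2 c ck.
by rewrite -(nth_mkseq false (f _) ck) f1 -(nth_mkseq false (u _) ck) f2 !nth_mkseq.
Qed.

Lemma tukey_ge_transfer M N : tukey_ge (trees M) (trees N) ->
  exists a, transfer a M = N.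
Proof.
move=> /tukey_ge_witness[phi [psi [phiP psiP galois]]].
have [N0|/set0P N0] := eqVneq N set0.
  (* For empty [N], take a constant sequence whose limit contains a string of length 1 but not the
     empty string, hence is no tree. *)
  have [a aE] := code_surj (fun=> (fun c => c == pref point 1, point)).
  exists a; rewrite N0; apply/seteqP; split=> // y [p [pt _ _] pa].
  have pE : p = (fun c => c == pref point 1).
    apply/funext => c; have [n /(_ _ (ltnSn c))[<- _]] := pa c.+1.
    by rewrite aE.
  have := pt point 0 1 (leqnSn 0); rewrite pE eqxx => /(_ isT) /eqP /pref_size.
  by [].
have [u [uN ud]] := dense_sequence (fun y => psi (singleton_tree y)) N0.
have [a aE] := code_surj (fun n => (psi (singleton_tree (u n)), u n)).
exists a; apply/seteqP; split=> y.
  move=> [p pM pa]; rewrite aE /= in pa.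
  have /choice[n nP] := pa.
  have uM k : trees M (psi (singleton_tree (u (n k)))).
    by apply: psiP; exact: singleton_treeP.
  (* The trees attached to the [u (n k)] converge to [p], so some [r] bounds them all; then [phi r]
     contains every initial segment of [y]. *)
  have [k c ck|r [rM pr qr]] := trees_limit_bounded pM uM.
    by have [] := nP k c ck.
  have [_ _] := phiP _ rM; apply => j.
  have := galois _ _ (singleton_treeP (uN (n j))) rM (qr j).
  move=> /pow_leP; apply; apply/asboolP; exists j.
  by apply: eq_pref => i ij; have [] := nP j i ij.
move=> Ny; exists (psi (singleton_tree y)); first by apply: psiP; exact: singleton_treeP.
by move=> k; have [n nP] := ud y k Ny; exists n; rewrite aE.
Qed.

Lemma tukey_ge_refl d (T : porderType d) (P : set T) : tukey_ge P P.
Proof.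
have idP : set_fun P P idfun by [].
have [f fE] := Pfun idP.
exists f => C [CP Ccof]; rewrite -fE image_id; split => //.
Qed.

End TreePosets.

(** * The cardinality of the continuum, and the conclusion *)

Lemma card_pow_omega : ~ ([set: pow_omega] #<= [set: nat]).
Proof.
move=> /(card_leE 0)[e [_ einj]].
pose d n := `[< exists2 x, e x = n & ~~ x n >].
have : d (e d) = ~~ d (e d); last by case: (d _).
apply/idP/idP => [/asboolP[x /einj -> //]|nd].
by apply/asboolP; exists d.
Qed.

Lemma card_pow_omega_seq : [set: nat -> pow_omega] #<= [set: pow_omega].
Proof.
apply: (@card_le_fun _ _ _ _ (fun s m =>
  if unpickle m is Some (n, c) then s n c else false)) => // s t _ _ st.
apply/funext => n; apply/funext => c.
by have := congr1 (@^~ (pickle (n, c))) st; rewrite /= pickleK.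
Qed.

(* The continuum is the cardinality of [pow_omega], so 2^c is the cardinality
   of the type [set pow_omega] of all its subsets. *)
Theorem theorem3p2 :
  exists A : set (set pow_omega),
    [/\ (forall P : set pow_omega, A P -> directed P),
        A #= [set: set pow_omega] &
        forall P Q : set pow_omega, A P -> A Q -> P <> Q ->
          ~ tukey_ge P Q /\ ~ tukey_ge Q P].
Proof.
(* Reflexivity of the Tukey order makes every [M] a transfer of itself. *)
have [Y [YT Yfree]] := large_free_family card_pow_omega card_pow_omega_seq
  transfer_mono transfer_countable (fun M => tukey_ge_transfer (tukey_ge_refl (trees M))).
have incomparable M N : Y M -> Y N -> M <> N -> ~ tukey_ge (trees M) (trees N).
  by move=> YM YN MN /tukey_ge_transfer[a]; exact: Yfree.
exists [set trees M | M in Y]; split.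
- by move=> _ [M _ <-]; exact: trees_directed.
- apply: card_eq_trans YT; apply: inj_card_eq => M N /set_mem YM /set_mem YN MN.
  apply: contrapT => /(incomparable _ _ YM YN); apply; rewrite MN.
  exact: tukey_ge_refl.
- move=> _ _ [M YM <-] [N YN <-] MN.
  by split; apply: incomparable => // E; apply: MN; rewrite E.
Qed.
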